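(* Let $G$ be a connected graph of order $n>1$ with vertex set $\{v_1,\ldots,v_n\}$ and let $\mathcal{H}=(H^1,H^2,\ldots,H^n)$ be a sequence of connected graphs. For each $i$, let $H^i_i$ denote the copy of $H^i$ in $G\odot\mathcal{H}$ attached to $v_i$, with vertices $u^i_{ij}$, $j=1,\ldots,|V(H^i)|$. Then $$D(G\odot\mathcal{H})=\{u^i_{ij}\in V(H^i_i)\mid v_i\in D(G)\},$$ that is, $D(G\odot\mathcal{H})$ is the union of the sets $V(H^i_i)$ over all $i$ with $v_i\in D(G)$.
   Context: Distances are shortest-path distances: $d_G(u,v)$ is the length of a shortest $u$–$v$ path in the connected graph $G$. The eccentricity of $v$ is $e_G(v)=\max_{u\in V(G)}d_G(u,v)$ and $\operatorname{diam}(G)=\max_v e_G(v)$. A vertex is diametral if its eccentricity equals $\operatorname{diam}(G)$; the diametral set $D(G)$ is the set of all diametral vertices of $G$. Generalized corona: for a graph $G$ with $V(G)=\{v_1,\ldots,v_n\}$ and a sequence of graphs $\mathcal{H}=(H^1,\ldots,H^n)$, $G\odot\mathcal{H}$ is the graph obtained by taking one copy of $G$ and one (disjoint) copy of each $H^i$, and joining the vertex $v_i$ of $G$ to every vertex of the copy of $H^i$, for each $i=1,\ldots,n$. *)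

(* Defs.v *)
From mathcomp Require Import all_boot.

Set Implicit Arguments.
Unset Strict Implicit.
Unset Printing Implicit Defensive.

(* Finite simple graphs. *)
Record sgraph := SGraph {
  vertex :> finType;
  edge : rel vertex;
  edge_sym : symmetric edge;
  edge_irrefl : irreflexive edge }.

Section Distance.
Variable G : sgraph.
Implicit Types (u v : G) (k : nat).

(* The null graph (no vertices) does not count as connected. *)
Definition connected_graph : Prop :=
  0 < #|G| /\ forall u v, connect (@edge G) u v.

(* [u :: p] lists the vertices of the path, so its length is [size p = k]. *)
Definition has_path u v k : bool :=
  [exists p : k.-tuple G,
     [&& path (@edge G) u p, last u p == v & uniq (u :: p)]].

(* A path has fewer than [#|G|] edges, so the range of [k] covers all paths;
   the value is the junk [#|G|] when [u] and [v] are not connected. *)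
Definition dist u v : nat :=
  \big[minn/#|G|]_(k < #|G| | has_path u v k) k.

Definition ecc v : nat := \max_(u : G) dist u v.

Definition diam : nat := \max_(v : G) ecc v.

Definition diametral_set : {set G} := [set v | ecc v == diam].

End Distance.

Section Corona.
Variables (G : sgraph) (H : G -> sgraph).

(* The graphs [H] are indexed by the vertices of [G] themselves; [inl v] is
   the vertex [v] of [G], and [inr (Tagged _ u)] with [u : H v] is the vertex
   [u] of the copy of [H v] attached to [v]. *)
Definition corona_vertex : finType := (G + {v : G & H v})%type.

(* When [tag a = tag b], [tagged_as a b] is [tagged b] seen in [H (tag a)]. *)
Definition corona_edge : rel corona_vertex := fun x y =>
  match x, y with
  | inl u, inl v => edge u v
  | inl v, inr b => v == tag b
  | inr a, inl v => v == tag a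
  | inr a, inr b => (tag a == tag b) && edge (tagged a) (tagged_as a b)
  end.

Lemma corona_edge_sym : symmetric corona_edge.
Proof.
move=> [u|[i a]] [v|[j b]] //=; first exact: edge_sym.
case: (eqVneq i j) => [ij | ij] //=.
by case: j / ij b => b; rewrite !tagged_asE edge_sym.
Qed.

Lemma corona_edge_irrefl : irreflexive corona_edge.
Proof.
move=> [u|[i a]] /=; first exact: edge_irrefl.
by rewrite eqxx tagged_asE edge_irrefl.
Qed.

Definition corona : sgraph := SGraph corona_edge_sym corona_edge_irrefl.

Definition corona_copy (v : G) : {set corona} :=
  [set (inr (Tagged (fun w : G => H w) u) : corona) | u : H v].

End Corona.

(* Main.v *)
Require Import Defs.
From mathcomp Require Import all_boot.

(** Let [base x] be the vertex of [G] below a corona vertex [x], and [height x]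
    be 1 or 0 according to whether [x] lies in a copy or in [G]. Then
    [d(x, y) <= d(base x, base y) + height x + height y], with equality when
    the bases differ. As [G] has at least two vertices and every copy is
    nonempty, [e(x) = e(base x) + 1 + height x]. The diameter therefore grows
    by exactly 2, and it is attained at the vertices of height 1 whose base is
    diametral. *)

Lemma bigminn_leq (I : eqType) (r : seq I) (P : pred I) (F : I -> nat) n j :
  j \in r -> P j -> \big[minn/n]_(i <- r | P i) F i <= F j.
Proof.
move=> + Pj; elim: r => // i r IHr; rewrite inE big_cons.
case/predU1P => [<- | /IHr le_j]; first by rewrite Pj geq_minl.
by case: ifP => // _; apply: leq_trans (geq_minr _ _) le_j.
Qed.

(** An admissible index with value below the default [n] keeps the minimum below [n], so the default
    is not what is returned. *)
Lemma bigminn_attained (I : eqType) (r : seq I) (P : pred I) (F : I -> nat) n :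
  (exists2 j, j \in r & P j && (F j < n)) ->
  exists2 i, P i & \big[minn/n]_(i <- r | P i) F i = F i.
Proof.
case=> j rj /andP[Pj Fj_lt].
have := bigminn_leq _ r P F n j rj Pj.
have [->|//] : \big[minn/n]_(i <- r | P i) F i = n \/
    exists2 i, P i & \big[minn/n]_(i <- r | P i) F i = F i.
  elim/big_rec: _ => [|i m Pi IHm]; first by left.
  by rewrite /minn; case: ifP => _; [right; exists i | exact: IHm].
by rewrite leqNgt Fj_lt.
Qed.

Section Distance.
Variable G : sgraph.
Implicit Types (u v w : G) (p : seq G).

Lemma has_path_uniq u p :
  path (@edge G) u p -> uniq (u :: p) -> has_path u (last u p) (size p).
Proof.
by move=> p_path p_uniq; apply/existsP; exists (in_tuple p); apply/and3P.
Qed.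

Lemma uniq_size_lt u p : uniq (u :: p) -> size p < #|G|.
Proof. by move/card_uniqP => /= <-; apply: max_card. Qed.

(** Repeated vertices are allowed in [p]: shortening it leaves a simple path whose vertices all
    occur in [p], hence one that is no longer. *)
Lemma dist_leq u p : path (@edge G) u p -> dist u (last u p) <= size p.
Proof.
case/shortenP=> q q_path q_uniq q_sub.
have q_lt := uniq_size_lt _ _ q_uniq.
have uniq_q : uniq q by case/andP: q_uniq.
apply: leq_trans (uniq_leq_size uniq_q q_sub).
apply: (bigminn_leq _ _ _ (fun k : 'I_#|G| => k : nat) _ (Ordinal q_lt)).
  exact: mem_index_enum.
exact: has_path_uniq.
Qed.

Lemma dist_path u v : connect (@edge G) u v ->
  exists p, [/\ path (@edge G) u p, last u p = v & size p = dist u v].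
Proof.
case/connectP=> _ /shortenP[q q_path q_uniq _] ->.
(* A simple path has fewer than [#|G|] edges, so its length is in the range of the minimum and beats
   the junk value. *)
have q_lt := uniq_size_lt _ _ q_uniq.
have [|k /existsP[p /and3P[p_path /eqP p_last _]] dist_k] :=
    bigminn_attained _ (index_enum 'I_#|G|)
      (fun k : 'I_#|G| => has_path u (last u q) k) (fun k => k : nat) #|G|.
  exists (Ordinal q_lt); first exact: mem_index_enum.
  by rewrite /= q_lt has_path_uniq.
by exists p; rewrite size_tuple /dist dist_k.
Qed.

Lemma distxx u : dist u u = 0.
Proof. by apply/eqP; rewrite -leqn0; exact: (dist_leq u [::]). Qed.

Lemma dist_edge u v w :
  connect (@edge G) v w -> edge u v -> dist u w <= (dist v w).+1.
Proof.
case/dist_path=> p [p_path <- <-] uv.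
by apply: (dist_leq u (v :: p)); rewrite /= uv.
Qed.

Lemma dist_gt0 u v : connect (@edge G) u v -> u != v -> 0 < dist u v.
Proof.
by case/dist_path=> [[|w p]] [_ <- <-] //=; rewrite eqxx.
Qed.

(** Along a shortest path [f] drops by at most 1 per edge. A well-chosen potential thus bounds a
    distance from below. *)
Lemma lipschitz_dist (f : G -> nat) u v :
  (forall x y, edge x y -> f x <= (f y).+1) ->
  connect (@edge G) u v -> f u <= f v + dist u v.
Proof.
move=> f_lip /dist_path[p [p_path <- <-]].
elim: p u p_path => [|w p IHp] u /=; first by rewrite addn0.
case/andP=> /f_lip f_uw /IHp f_w; apply: leq_trans f_uw _.
by rewrite addnS ltnS.
Qed.

Lemma leq_dist_ecc u v : dist u v <= ecc v.
Proof. exact: leq_bigmax. Qed.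

Lemma leq_ecc_diam v : ecc v <= diam G.
Proof. exact: leq_bigmax. Qed.

Lemma ecc_attained v : exists u, dist u v = ecc v.
Proof.
have G_gt0 : 0 < #|G| by apply/card_gt0P; exists v.
by have [u max_u] := eq_bigmax (fun u => dist u v) G_gt0; exists u.
Qed.

Lemma diam_attained : 0 < #|G| -> exists v, ecc v = diam G.
Proof. by case/(eq_bigmax (@ecc G)) => v max_v; exists v. Qed.

End Distance.

Section Corona.
Variables (G : sgraph) (H : G -> sgraph).
Hypothesis G_conn : forall u v : G, connect (@edge G) u v.
Implicit Types x y : corona H.

Definition base x : G := match x with inl v => v | inr a => tag a end.

Definition height x : nat := if x is inr _ then 1 else 0.

(** Step down from [x] to its base if [x] lies in a copy, follow a shortest path of [G], then step
    up to [y] if [y] lies in a copy ([suff]). *)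
Lemma corona_path x y : exists p : seq (corona H),
  [/\ path (@edge (corona H)) x p, last x p = y
    & size p = dist (base x) (base y) + height x + height y].
Proof.
have [q [q_path q_last <-]] := dist_path _ _ _ (G_conn (base x) (base y)).
pose inG v : corona H := inl v.
have lift_path v : path (@edge (corona H)) (inG v) (map inG q)
    = path (@edge G) v q by rewrite path_map.
pose suff := if height y is 0 then [::] else [:: y].
have suff_path : path (@edge (corona H)) (inG (base y)) suff.
  by rewrite /suff; case: (y) => [v|a] //=; rewrite /edge /= eqxx.
have suff_last : last (inG (base y)) suff = y by rewrite /suff; case: (y).
have suff_size : size suff = height y by rewrite /suff; case: (y).
pose r := map inG q ++ suff.
have r_path : path (@edge (corona H)) (inG (base x)) r.
  by rewrite cat_path lift_path q_path last_map q_last.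
have r_last : last (inG (base x)) r = y by rewrite last_cat last_map q_last.
have r_size : size r = size q + height y by rewrite size_cat size_map suff_size.
case: x => [v|a] in q_path q_last r_path r_last *.
  by exists r; rewrite addn0.
exists (inG (tag a) :: r); split=> //=; last by rewrite r_size addn1.
by rewrite r_path andbT /edge /= eqxx.
Qed.

Lemma corona_connect x y : connect (@edge (corona H)) x y.
Proof.
by have [p [p_path p_last _]] := corona_path x y; apply/connectP; exists p.
Qed.

Lemma corona_dist_leq x y :
  dist x y <= dist (base x) (base y) + height x + height y.
Proof. by have [p [p_path <- <-]] := corona_path x y; apply: dist_leq. Qed.

(** The bases must differ: adjacent vertices of one copy are at distance 1, while the sum is 2. *)
Lemma corona_dist_geq x y : base x != base y ->
  dist (base x) (base y) + height x + height y <= dist x y.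
Proof.
move=> xy_neq.
(* Setting the potential to 0 on the copy above [base y] makes it vanish at
   [y] while keeping it 1-Lipschitz. *)
pose f z := if (base z == base y) && (0 < height z) then 0
            else dist (base z) (base y) + height z + height y.
have fy0 : f y = 0.
  by rewrite /f eqxx /= distxx; case: (y).
have y_le1 : height y <= 1 by case: (y).
have -> : dist (base x) (base y) + height x + height y = f x.
  by rewrite /f (negPf xy_neq).
rewrite -[dist x y]add0n -fy0; apply: lipschitz_dist (corona_connect x y).
move=> [u|a] [v|b]; rewrite /edge /f /=.
- move=> uv; rewrite !andbF !addn0 -addSn leq_add2r.
  exact: dist_edge (G_conn _ _) uv.
- move/eqP->; rewrite andbF andbT.
  (* On an edge from [base y] up into its copy, [f] drops from [height y] to 0; this is where
     [y_le1] enters. *)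
  case: eqP => [->|_]; first by rewrite distxx.
  by rewrite addn0 addn1 addSn !leqW.
- move/eqP->; rewrite andbF andbT.
  by case: eqP => // _; rewrite addn0 addn1 addSn.
- by case/andP=> /eqP ab _; rewrite ab.
Qed.

Hypothesis H_gt0 : forall v, 0 < #|H v|.
Hypothesis G_order : 1 < #|G|.

Lemma ecc_gt0 (v : G) : 0 < ecc v.
Proof.
have [u] : exists u, u \in predC1 v.
  by apply/card_gt0P; rewrite cardC1 -subn1 subn_gt0.
move=> uv; apply: leq_trans (leq_dist_ecc _ u v).
exact: dist_gt0 (G_conn u v) uv.
Qed.

(** From above, the other endpoint has height at most 1. From below, take a vertex in the copy over
    some [u] farthest from [base x] in [G]. *)
Lemma corona_ecc x : ecc x = ecc (base x) + height x + 1.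
Proof.
apply/eqP; rewrite eqn_leq; apply/andP; split.
  apply/bigmax_leqP=> y _; apply: leq_trans (corona_dist_leq y x) _.
  rewrite addnAC leq_add ?leq_add ?leq_dist_ecc //.
  by case: (y).
have [u dist_u] := ecc_attained _ (base x).
(* Since [G] has a second vertex, the eccentricity of [base x] is positive, so the exact distance
   formula applies over [u]. *)
have ux_neq : u != base x.
  by apply/eqP=> ux; have := ecc_gt0 (base x); rewrite -dist_u ux distxx.
have [a _] := card_gt0P (H_gt0 u).
pose y : corona H := inr (Tagged (fun w : G => H w) a).
apply: leq_trans (leq_dist_ecc _ y x).
by rewrite -dist_u addnAC; apply: (corona_dist_geq y x).
Qed.

Lemma corona_diam : diam (corona H) = diam G + 2.
Proof.
apply/eqP; rewrite eqn_leq; apply/andP; split.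
  apply/bigmax_leqP=> x _; rewrite corona_ecc -addnA leq_add ?leq_ecc_diam //.
  by case: (x).
have [v <-] := diam_attained _ (ltnW G_order).
have [a _] := card_gt0P (H_gt0 v).
pose x : corona H := inr (Tagged (fun w : G => H w) a).
by apply: leq_trans (leq_ecc_diam _ x); rewrite corona_ecc -addnA.
Qed.

End Corona.

Theorem lemma3p2 (G : sgraph) (H : G -> sgraph)
    (G_conn : connected_graph G) (G_order : 1 < #|G|)
    (H_conn : forall v : G, connected_graph (H v)) :
  diametral_set (corona H) =
    \bigcup_(v in diametral_set G) corona_copy H v.
Proof.
have conn := proj2 G_conn; have H_gt0 v := proj1 (H_conn v).
apply/setP=> x; rewrite inE corona_ecc // corona_diam //.
apply/idP/bigcupP => [|[v]].
  case: x => [v|[v a]] /=.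
    (* A diametral vertex at height 0 would have eccentricity [diam G + 1] in [G]. *)
    rewrite addn0 (addnS _ 1) -addSn eqn_add2r => /eqP ecc_v.
    by have := leq_ecc_diam _ v; rewrite ecc_v ltnn.
  rewrite -addnA eqn_add2r => ecc_v.
  by exists v; rewrite ?inE //; apply/imsetP; exists a.
rewrite inE => /eqP ecc_v /imsetP[a _ ->] /=.
by rewrite ecc_v -addnA.
Qed.
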